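(* Let $X$ be a separable metric space equipped with a locally finite Borel measure $\mu$ (not necessarily finite), and let $T:X\to X$ be a measurable map such that $\mu$ is $T$-invariant. Then for each fixed $y\in X$, the inequalities $$\underline{R}(x,y)\geq \underline{d}_\mu(y)\quad\text{and}\quad \overline{R}(x,y)\geq \overline{d}_\mu(y)$$ hold for $\mu$-almost every $x\in X$.
   Context: $B(y,r)$ denotes the (open) ball with center $y$ and radius $r$. Locally finite means every point has a neighborhood of finite measure. $\mu$ is $T$-invariant if $\mu(T^{-1}(A))=\mu(A)$ for every Borel set $A$. First entrance time: $\tau_r(x,y)=\min\{n\in\mathbb{N}: n>0,\ T^n(x)\in B(y,r)\}$, with $\tau_r(x,y)=\infty$ if there is no such $n$. Recurrence indicators: $$\overline R(x,y)=\limsup_{r\to 0}\frac{\log \tau_r(x,y)}{-\log r},\qquad \underline R(x,y)=\liminf_{r\to 0}\frac{\log \tau_r(x,y)}{-\log r};$$ if $\tau_r(x,y)=\infty$ for some $r>0$, both $\overline R(x,y)$ and $\underline R(x,y)$ are set equal to $+\infty$. Local dimensions of $\mu$ at $y$: $$\overline d_\mu(y)=\limsup_{r\to 0}\frac{\log \mu(B(y,r))}{\log r},\qquad \underline d_\mu(y)=\liminf_{r\to 0}\frac{\log \mu(B(y,r))}{\log r},$$ with the convention $\log 0=-\infty$ (so both equal $+\infty$ if some ball around $y$ has measure zero). All these quantities take values in $[0,+\infty]$. *)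

(* Defs.v *)
(* MathComp-Analysis. *)
From HB Require Import structures.
From mathcomp Require Import all_boot all_order all_algebra.
From mathcomp Require Import all_classical all_reals all_analysis.

Set Implicit Arguments.
Unset Strict Implicit.
Unset Printing Implicit Defensive.

Import Order.TTheory GRing.Theory Num.Theory.
Import numFieldNormedType.Exports.

Local Open Scope classical_set_scope.
Local Open Scope ring_scope.

(* The join carries no compatibility axiom between the metric and the sigma
   algebra; that the sigma algebra is the Borel one is [borel_measurable].
   [Measurable] extends [Pointed], so such a type is never empty. *)
#[short(type="measurableMetricType")]
HB.structure Definition MeasurableMetric d (R : numDomainType) :=
  { X of Metric R X & Measurable d X }.

Definition borel_measurable d (R : realType) (X : measurableMetricType d R) :
  Prop := @measurable d X = <<s @open X >>.

Definition separable_space (X : topologicalType) : Prop :=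
  exists2 D : set X, countable D & dense D.

Definition locally_finite d (R : realType) (X : measurableMetricType d R)
    (mu : {measure set X -> \bar R}) : Prop :=
  forall x : X, exists U : set X,
    [/\ nbhs x U, measurable U & (mu U < +oo)%E].

Definition invariant_measure d (R : realType) (X : measurableMetricType d R)
    (mu : {measure set X -> \bar R}) (T : X -> X) : Prop :=
  forall A : set X, measurable A -> mu (T @^-1` A) = mu A.

(* An infimum of a set of natural numbers is a minimum, and the infimum of the
   empty set is +oo. *)
Definition entrance_time (R : realType) (X : metricType R) (T : X -> X)
    (r : R) (x y : X) : \bar R :=
  ereal_inf [set n%:R%:E | n in [set n : nat | (0 < n)%N /\
                                               ball y r (iter n T x)]].

Section recurrence.
Local Open Scope ereal_scope.
Context (R : realType) (X : metricType R).
Variable (T : X -> X).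
Implicit Types (x y : X).

Definition recurrence_ratio x y (r : R) : \bar R :=
  lne (entrance_time T r x y) / (- ln r)%:E.

Definition misses_some_ball x y : Prop :=
  exists2 r : R, (0 < r)%R & entrance_time T r x y = +oo.

Definition upper_recurrence x y : \bar R :=
  if `[< misses_some_ball x y >] then +oo
  else limf_esup (recurrence_ratio x y) 0^'+.

Definition lower_recurrence x y : \bar R :=
  if `[< misses_some_ball x y >] then +oo
  else limf_einf (recurrence_ratio x y) 0^'+.

End recurrence.

Section local_dimension.
Local Open Scope ereal_scope.
Context d (R : realType) (X : measurableMetricType d R).
Variable (mu : {measure set X -> \bar R}).

(* [lne 0 = -oo], and [-oo / (ln r)%:E = +oo] when [0 < r < 1]. *)
Definition dimension_ratio (y : X) (r : R) : \bar R :=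
  lne (mu (ball y r)) / (ln r)%:E.

Definition upper_local_dimension (y : X) : \bar R :=
  limf_esup (dimension_ratio y) 0^'+.

Definition lower_local_dimension (y : X) : \bar R :=
  limf_einf (dimension_ratio y) 0^'+.

End local_dimension.

(* Main.v *)
(* By invariance, the points entering B(y,r) within K steps have measure at most
   K mu(B(y,r)). For 0 <= b < a and r_n = e^-n, applying this with K of order
   r_n^-b at those scales where mu(B(y,r_n)) is of order at most r_n^a yields a
   geometric series, so by Borel-Cantelli almost every x eventually has
   tau_{r_n}(x,y) > r_n^-b at all such scales. Interpolating between consecutive
   scales costs a constant factor in the radius, which does not change the limits
   superior and inferior; then let (a,b) range over pairs of rationals. *)
Require Import Defs.
From mathcomp Require Import all_boot all_order all_algebra.
From mathcomp Require Import all_classical all_reals all_analysis.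
From mathcomp Require Import lra.

Set Implicit Arguments.
Unset Strict Implicit.
Unset Printing Implicit Defensive.

Import Order.TTheory GRing.Theory Num.Theory.
Import numFieldNormedType.Exports.

Local Open Scope classical_set_scope.
Local Open Scope ring_scope.

Lemma metric_ball_open (R : realType) (X : metricType R) (y : X) (r : R) :
  open (ball y r).
Proof.
rewrite openE => z; rewrite ballEmdist/= => yzr.
apply/nbhs_ballP; exists (r - mdist y z); first by rewrite /= subr_gt0.
move=> w; rewrite !ballEmdist/= => zw.
by rewrite (le_lt_trans (metric_triangle _ z _))//; lra.
Qed.

Lemma geometric_nneseries_lty (R : realType) (a z : R) :
  `|z| < 1 -> (\sum_(n <oo) (geometric a z n)%:E < +oo)%E.
Proof.
move=> z1; have /cvg_lim -> // : eseries (EFin \o geometric a z) @ \oo -->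
    (a * (1 - z)^-1)%:E.
  apply: cvg_EFin.
    by apply: nearW => n; rewrite /eseries/= sumEFin.
  rewrite [X in X @ _ --> _](_ : _ = series (geometric a z)).
    exact: cvg_geometric_series.
  by apply/funext => n; rewrite /= /eseries/= sumEFin.
exact: ltry.
Qed.

(** Two rationals, not one: the eventual comparisons below lose a little between the two thresholds,
    and rational thresholds keep the exceptional null sets countable in number. *)
Lemma ereal_between_rat (R : realType) (x y : \bar R) : (x < y)%E ->
  exists p q : rat, [/\ ratr p < ratr q :> R, (x < (ratr p)%:E)%E &
                        ((ratr q)%:E < y)%E].
Proof.
move=> xy.
have [u [v [uv xu vy]]] : exists u v : R,
    [/\ u < v, (x <= u%:E)%E & (v%:E <= y)%E].
  case: x y xy => [x| |] [y| |]//= xy.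
  - by exists x, y.
  - by exists x, (x + 1); rewrite ltrDl leey.
  - by exists (y - 1), y; rewrite leNye ltrBlDr ltrDl.
  - by exists 0, 1; rewrite leNye leey.
have /rat_in_itvoo[p] := uv; rewrite in_itv/= => /andP[up pv].
have /rat_in_itvoo[q] := pv; rewrite in_itv/= => /andP[pq qv].
exists p, q; split => //; first exact: le_lt_trans xu _.
exact: lt_le_trans vy.
Qed.

(** * Comparison of limits at 0 across a rescaling of the radius *)

Section limf_scaling.
Context (R : realType).

Lemma near_at_right0_scale (c : R) (P : set R) : 0 < c ->
  (\forall r \near 0^'+, P r) -> \forall r \near 0^'+, P (c * r).
Proof.
move=> c0 [e /= e0 eP]; exists (e / c); first by rewrite /= divr_gt0.
move=> r /=; rewrite sub0r normrN => re r0; apply: eP => /=; last first.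
  by rewrite mulr_gt0.
by rewrite sub0r normrN normrM (gtr0_norm c0) mulrC -ltr_pdivlMr.
Qed.

Variables (c : R) (f g : R -> \bar R).
Hypothesis c0 : 0 < c.
Hypothesis fg : forall p q : rat, ratr p < ratr q :> R ->
  \forall r \near 0^'+, ((ratr q)%:E < f r)%E -> ((ratr p)%:E <= g (c * r))%E.

(** Otherwise rationals [p < q] separate the two limits; eventually [g (c * r) < p], and the
    contrapositive of [fg] keeps [f] eventually at most [q]. *)
Lemma limf_esup_le_scale : (limf_esup f 0^'+ <= limf_esup g 0^'+)%E.
Proof.
rewrite leNgt; apply/negP => /ereal_between_rat[p [q [pq gp qf]]].
have [_ [V V0 <-] Vp] := ereal_inf_lt gp.
have gV : \forall r \near 0^'+, (g r < (ratr p)%:E)%E.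
  apply: filterS V0 => r Vr; apply: le_lt_trans Vp.
  by apply: ereal_sup_ubound; exists r.
have gcV := near_at_right0_scale c0 gV.
suff : (limf_esup f 0^'+ <= (ratr q)%:E)%E by rewrite leNgt qf.
have fV : \forall r \near 0^'+, (f r <= (ratr q)%:E)%E.
  near=> r; rewrite leNgt; apply/negP.
  have pg : ((ratr q)%:E < f r)%E -> ((ratr p)%:E <= g (c * r))%E.
    by near: r; exact: fg.
  move=> /pg; rewrite leNgt; apply/negP/negPn.
  by near: r.
(* The upper limit is an infimum over neighbourhoods; the sublevel set of [f] at [q] is one of
   them. *)
apply: (@le_trans _ _
    (ereal_sup [set f r | r in [set r | (f r <= (ratr q)%:E)%E]])).
  by apply: ereal_inf_lbound; eexists; first exact: fV.
by apply: ge_ereal_sup => _ [r /= fr <-].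
Unshelve. all: by end_near.
Qed.

Lemma limf_einf_le_scale : (limf_einf f 0^'+ <= limf_einf g 0^'+)%E.
Proof.
rewrite !limf_einfE leNgt; apply/negP => /ereal_between_rat[p [q [pq gp qf]]].
have [_ [V V0 <-] qV] := ereal_sup_gt qf.
suff : (ereal_sup [set ereal_inf (g @` V) | V in 0^'+] >= (ratr p)%:E)%E.
  by rewrite leNgt gp.
have gV : \forall r \near 0^'+, ((ratr p)%:E <= g (c * r))%E.
  near=> r.
  have pg : ((ratr q)%:E < f r)%E -> ((ratr p)%:E <= g (c * r))%E.
    by near: r; exact: fg.
  apply: pg; apply: lt_le_trans qV _.
  apply: ereal_inf_lbound; exists r => //; near: r; exact: V0.
(* Substituting [c^-1 * r] for [r] removes the factor [c]. *)
have {}gV : \forall r \near 0^'+, ((ratr p)%:E <= g r)%E.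
  have ci0 : 0 < c^-1 by rewrite invr_gt0.
  apply: filterS (near_at_right0_scale ci0 gV) => r /=.
  by rewrite mulrA divff ?gt_eqF// mul1r.
apply: (@le_trans _ _
    (ereal_inf [set g r | r in [set r | ((ratr p)%:E <= g r)%E]])).
  by apply: le_ereal_inf_tmp => _ [r /= gr <-].
by apply: ereal_sup_ubound; eexists; first exact: gV.
Unshelve. all: by end_near.
Qed.

End limf_scaling.

(** * Invariance and Borel-Cantelli for visits to shrinking targets *)

Section early_visits.
Context d (R : realType) (X : measurableType d).
Variables (mu : {measure set X -> \bar R}) (T : X -> X).
Hypothesis mT : measurable_fun [set: X] T.
Hypothesis muT : forall A, measurable A -> mu (T @^-1` A) = mu A.

Lemma measurable_iter n : measurable_fun [set: X] (iter n T).
Proof.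
by elim: n => [|n IHn]; [exact: measurable_id | exact: (measurableT_comp mT)].
Qed.

Lemma measurable_iter_preimage n (B : set X) :
  measurable B -> measurable (iter n T @^-1` B).
Proof.
by move=> mB; rewrite -[X in measurable X]setTI; exact: measurable_iter.
Qed.

Lemma measure_iter_preimage n (B : set X) :
  measurable B -> mu (iter n T @^-1` B) = mu B.
Proof.
move=> mB; elim: n => [//|n IHn].
(* Applying [T] first and [iter n T] afterwards exhibits the set as a preimage by [T], to which
   invariance applies. *)
rewrite -IHn -[RHS]muT; last exact: measurable_iter_preimage.
by congr (mu _); apply/funext => x /=; rewrite -iterS iterSr.
Qed.

(** The shift to [k.+1] discards time 0: the times counted are 1 to [K]. *)
Definition early_visits K (B : set X) : set X :=
  \big[setU/set0]_(k < K) (iter k.+1 T @^-1` B).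

Lemma measurable_early_visits K (B : set X) :
  measurable B -> measurable (early_visits K B).
Proof.
move=> mB; apply: bigsetU_measurable => k _; exact: measurable_iter_preimage.
Qed.

Lemma measure_early_visits_le K (B : set X) :
  measurable B -> (mu (early_visits K B) <= K%:R%:E * mu B)%E.
Proof.
move=> mB; rewrite /early_visits.
apply: le_trans (Boole_inequality (A := fun k => iter k.+1 T @^-1` B) _ _) _.
  by move=> k _; exact: measurable_iter_preimage.
rewrite (eq_bigr (fun=> mu B)); last first.
  by move=> k _; exact: measure_iter_preimage.
by rewrite mule_natl sumr_const card_ord; exact: lexx.
Qed.

Lemma ae_near_no_early_visit (B : (set X)^nat) (K : nat -> nat) :
  (forall n, measurable (B n)) ->
  (\sum_(n <oo) (K n)%:R%:E * mu (B n) < +oo)%E ->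
  {ae mu, forall x, \forall n \near \oo,
    forall k, (k < K n)%N -> ~ B n (iter k.+1 T x)}.
Proof.
move=> mB KB.
have mF n : measurable (early_visits (K n) (B n)).
  exact: measurable_early_visits.
exists (lim_sup_set (fun n => early_visits (K n) (B n))); split.
- apply: bigcap_measurable => // n _.
  by apply: bigcup_measurable => k _; exact: mF.
- apply: lim_sup_set_cvg0 => //; apply: le_lt_trans KB.
  by apply: lee_nneseries => // n _; exact: measure_early_visits_le.
(* A point outside the upper limit set makes early visits at only finitely many indices. *)
- move=> x /= xE n _; apply: contrapT => nx; apply: xE.
  exists n => // m /= nm k kK Bk; apply: nx; exists m => //=.
  rewrite /early_visits -(bigcup_mkord _ (fun k => iter k.+1 T @^-1` B m)).
  by exists k.
Qed.

End early_visits.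

(** * Entrance times against ball measures *)

Section recurrence_rate.
Context d (R : realType) (X : measurableMetricType d R).
Variables (mu : {measure set X -> \bar R}) (T : X -> X).
Implicit Types (x y : X) (r : R).

(** Entrance times are at least 1, so their logarithm is nonnegative, and [- ln r] is positive. *)
Lemma recurrence_ratio_ge0 x y r :
  0 < r < 1 -> (0 <= recurrence_ratio T x y r)%E.
Proof.
move=> /andP[r0 r1]; have lnr : 0 < - ln r by rewrite oppr_gt0 ln_lt0// r0.
rewrite /recurrence_ratio inver gt_eqF// lee_pdivlMr// mul0e lne_ge0.
apply: le_ereal_inf_tmp => _ [n [n0 _] <-].
by rewrite lee_fin ler1n.
Qed.

(** Excluding times 1 to [K] gains one more unit, which later absorbs the truncation of a real bound
    to [K]. *)
Lemma entrance_time_ge x y r K :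
  (forall k, (k < K)%N -> ~ ball y r (iter k.+1 T x)) ->
  (K.+1%:R%:E <= entrance_time T r x y)%E.
Proof.
move=> xK; apply: le_ereal_inf_tmp => _ [n [+ Bn] <-]; case: n Bn => // n Bn _.
rewrite lee_fin ler_nat ltnS leqNgt; apply/negP => nK; exact: xK Bn.
Qed.

Lemma le_entrance_time x y r s :
  r <= s -> (entrance_time T s x y <= entrance_time T r x y)%E.
Proof.
move=> rs; apply: ereal_inf_le_tmp => _ [n [n0 Bn] <-].
by exists n => //; split => //; exact: le_ball Bn.
Qed.

Hypothesis borelX : borel_measurable X.
Hypothesis mT : measurable_fun [set: X] T.
Hypothesis muT : invariant_measure mu T.

Lemma measurable_metric_ball y r : measurable (ball y r).
Proof. by rewrite borelX; apply: sub_sigma_algebra; exact: metric_ball_open. Qed.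

(** If [e^-n < r <= e^(1-n)], then [B n] lies between the balls of radii [r / e] and [r]: the outer
    inclusion passes the measure bound to [B n], the inner one passes the entrance bound to radius
    [r / e]. *)
Lemma ae_recurrence_ratio_ge_pos y (a b : R) : 0 <= b -> b < a ->
  {ae mu, forall x, \forall r \near 0^'+,
    (a%:E < dimension_ratio mu y r)%E ->
    (b%:E <= recurrence_ratio T x y (expR (-1) * r))%E}.
Proof.
move=> b0 ba.
pose B n := ball y (expR (- n%:R) : R).
(* The extra factors [e^a] and [e^b] pay for replacing [r] by [e^-n]. At scales with too large a
   measure, [K n = 0] makes the term vanish, even for infinite measure. *)
pose K n := if (mu (B n) < (expR (a - a * n%:R))%:E)%E
            then Num.truncn (expR (b + b * n%:R)) else 0%N.
have mB n : measurable (B n) by exact: measurable_metric_ball.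
have KB n : ((K n)%:R%:E * mu (B n) <=
             (geometric (expR (a + b)) (expR (b - a)) n)%:E)%E.
  rewrite /K; case: ifPn => [muB|_]; last first.
    by rewrite mul0e lee_fin geometric_ge0 ?expR_ge0.
  have -> : geometric (expR (a + b)) (expR (b - a)) n =
            expR (b + b * n%:R) * expR (a - a * n%:R) :> R.
    by rewrite /= -expRM_natl -!expRD; congr expR; lra.
  rewrite EFinM lee_pmul ?lee_fin ?ler0n//; last exact: ltW.
  by rewrite truncn_le ?expR_ge0.
have KBlty : (\sum_(n <oo) (K n)%:R%:E * mu (B n) < +oo)%E.
  apply: le_lt_trans
    (geometric_nneseries_lty (expR (a + b)) (z := expR (b - a)) _).
    by apply: lee_nneseries => // n _; rewrite mule_ge0// lee_fin.
  by rewrite ger0_norm ?expR_ge0// -expR0 ltr_expR subr_lt0.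
apply: filterS (ae_near_no_early_visit mT muT mB KBlty) => x [N _ xN].
near=> r => dr.
have r0 : 0 < r by [].
have r1 : r < 1 by near: r; exact: nbhs_right_lt.
have rN : r < expR (- N%:R) by near: r; apply: nbhs_right_lt; exact: expR_gt0.
have lnr : ln r < 0 by rewrite ln_lt0// r0.
have Nlnr : N%:R < - ln r by rewrite ltrNr -ltr_expR lnK.
pose n := (Num.truncn (- ln r)).+1.
have /andP[nlnr lnrn] : n%:R - 1 <= - ln r < n%:R.
  have /andP[h1 h2] : (Num.truncn (- ln r))%:R <= - ln r < n%:R.
    by apply: truncn_itv; rewrite oppr_ge0 ltW.
  by rewrite h2 andbT; apply: le_trans h1; rewrite /n -natr1 addrK.
have Nn : (N <= n)%N by rewrite -(ler_nat R); lra.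
have muB : (mu (B n) < (expR (a - a * n%:R))%:E)%E.
  (* Clearing the negative denominator [ln r] reverses the inequality, giving [mu (ball y r) < r^a]
     after exponentiation. *)
  have : (lne (mu (ball y r)) < a%:E * (ln r)%:E)%E.
    by move: dr; rewrite /dimension_ratio inver lt_eqF// lte_ndivlMr.
  rewrite -lte_expeR -EFinM lneK ?in_itv/= ?measure_ge0 ?leey// => muBr.
  have BnBr : (mu (B n) <= mu (ball y r))%E.
    apply: le_measure; rewrite ?inE//; first exact: measurable_metric_ball.
    apply: le_ball; rewrite -ler_ln ?posrE ?expR_gt0// expRK; lra.
  apply: le_lt_trans BnBr _; apply: lt_le_trans muBr _.
  rewrite lee_fin ler_expR; nra.
have lns : ln (expR (-1) * r) = ln r - 1.
  by rewrite lnM ?posrE ?expR_gt0// expRK addrC.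
have s0 : 0 < expR (-1) * r by rewrite mulr_gt0// expR_gt0.
rewrite /recurrence_ratio inver gt_eqF lns; last lra.
rewrite lee_pdivlMr; last lra.
have : ((expR (b + b * n%:R))%:E <= entrance_time T (expR (-1) * r) x y)%E.
  apply: (@le_trans _ _ (entrance_time T (expR (- n%:R)) x y)); last first.
    apply: le_entrance_time; rewrite -ler_ln ?posrE ?expR_gt0// expRK lns; lra.
  (* At this scale [K n] is the integer part of [e^(b + b n)], so [K n + 1] exceeds that number. *)
  apply: le_trans (entrance_time_ge (K := K n) _); last exact: xN.
  by rewrite lee_fin /K muB ltW// truncnS_gt.
move=> tau.
rewrite -lee_expeR lneK; last first.
  by rewrite in_itv/= leey andbT; apply: le_trans tau; rewrite lee_fin expR_ge0.
apply: le_trans tau; rewrite -EFinM lee_fin ler_expR; nra.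
Unshelve. all: by end_near.
Qed.

Lemma ae_recurrence_ratio_ge y (a b : R) : b < a ->
  {ae mu, forall x, \forall r \near 0^'+,
    (a%:E < dimension_ratio mu y r)%E ->
    (b%:E <= recurrence_ratio T x y (expR (-1) * r))%E}.
Proof.
(* A negative [b] lies below every recurrence ratio at small radii, for all [x]. *)
move=> ba; have [b0|b0] := leP 0 b; first exact: ae_recurrence_ratio_ge_pos.
apply: aeW => x.
have rec0 : \forall r \near 0^'+, (0 <= recurrence_ratio T x y r)%E.
  near=> r; have r1 : r < 1 by near: r; exact: nbhs_right_lt.
  by apply: recurrence_ratio_ge0; rewrite r1 andbT.
apply: filterS (near_at_right0_scale (expR_gt0 (-1)) rec0) => r /= + _.
by apply: le_trans; rewrite lee_fin ltW.
Unshelve. all: by end_near.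
Qed.

End recurrence_rate.

Theorem theorem4 (R : realType) (d : measure_display)
    (X : measurableMetricType d R)
    (hborel : borel_measurable X)
    (hsep : separable_space X)
    (mu : {measure set X -> \bar R})
    (hfin : locally_finite mu)
    (T : X -> X)
    (hT : measurable_fun [set: X] T)
    (hinv : invariant_measure mu T)
    (y : X) :
  {ae mu, forall x : X,
    (lower_local_dimension mu y <= lower_recurrence T x y)%E /\
    (upper_local_dimension mu y <= upper_recurrence T x y)%E}.
Proof.
(* Numbering the rational pairs by naturals lets a countable intersection of almost sure events give
   one full-measure set for all pairs. *)
pose P (n : nat) (x : X) := forall pq : rat * rat, unpickle n = Some pq ->
  ratr pq.1 < ratr pq.2 :> R ->
  \forall r \near 0^'+, ((ratr pq.2)%:E < dimension_ratio mu y r)%E ->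
    ((ratr pq.1)%:E <= recurrence_ratio T x y (expR (-1) * r))%E.
have : {ae mu, forall x, forall n, P n x}.
  apply: ae_foralln => n; rewrite /P.
  case: (unpickle n) => [[p q]|]; last exact: aeW.
  have [pq|qp] := ltP (ratr p : R) (ratr q); last first.
    by apply: aeW => x _ [<-]/=; rewrite ltNge qp.
  have := ae_recurrence_ratio_ge hborel hT hinv y pq.
  by apply: filterS => x xpq _ [<-].
apply: filterS => x xP.
have fg (p q : rat) : ratr p < ratr q :> R -> \forall r \near 0^'+,
    ((ratr q)%:E < dimension_ratio mu y r)%E ->
    ((ratr p)%:E <= recurrence_ratio T x y (expR (-1) * r))%E.
  exact: (xP (pickle (p, q)) (p, q) (pickleK _)).
(* If some ball is never entered, both indicators are [+oo] by convention. *)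
rewrite /lower_recurrence /upper_recurrence; case: asboolP => _.
  by rewrite !leey.
split; [apply: limf_einf_le_scale fg | apply: limf_esup_le_scale fg];
  exact: expR_gt0.
Qed.
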